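(* Let $K\subseteq\{1,2,\dots,n\}$. The intersection $U_{J,\geq 0}^-\cap B^+\dot w_KP_J^+$ is a connected component of $U_J^-\cap B^+\dot w_KP_J^+$, and $$U_{J,\geq 0}^-\cap B^+\dot w_KP_J^+=\left\{\begin{bmatrix}I_n&0\\S&I_n\end{bmatrix}\;\bigg|\;S\in C_K\right\}\simeq\mathbb R_{>0}^{\#K}\times\mathbb R^{\sum_{k\in K}(n-k)},$$ where $\simeq$ denotes a homeomorphism.
   Context: Let $n\ge1$, $e_1,\dots,e_{2n}$ the standard basis of $\mathbb R^{2n}$, and $G=Sp_{2n}(\mathbb R)$ for the symplectic form $\begin{bmatrix}0&I_n\\-I_n&0\end{bmatrix}$. $P_J^+$ is the subgroup of matrices in $G$ with zero lower left $n\times n$ block, and $B^+$ the subgroup of those $\begin{bmatrix}A&B\\0&(A^t)^{-1}\end{bmatrix}\in G$ with $A$ upper triangular. $U_J^-=\{\begin{bmatrix}I_n&0\\C&I_n\end{bmatrix}:C\text{ real symmetric}\}$ and $U_{J,\ge0}^-$ is its subset with $C$ positive semi-definite. Topology is Euclidean. The Weyl group $W$ of $G$ is identified with the group of permutations $\sigma$ of $\{\pm1,\dots,\pm n\}$ with $\sigma(-i)=-\sigma(i)$: a lift $\dot w\in G$ of $w$ (in the normalizer of the diagonal torus) satisfies $\dot we_i=\pm e_{w(i)}$, where $e_{-k}:=e_{n+k}$. Let $s_i$ ($1\le i\le n-1$) exchange $i$ and $i+1$ (and $-i$, $-(i+1)$) and $s_n=t$ exchange $n$ and $-n$. For $K\subseteq\{1,\dots,n\}$,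 $w_K=\prod^{\downarrow}_{k\in K}(s_ks_{k+1}\cdots s_{n-1}t)$, the factors being multiplied from left to right in decreasing order of $k\in K$ (the factor for $k=n$ is $t$). Let $M_K=\{A\in\mathrm{Mat}_{n\times n}(\mathbb R): A_{i,j}=0\text{ whenever }i<j\text{ or }j\notin K,\text{ and }A_{k,k}>0\text{ for }k\in K\}$ and $C_K=\{AA^t:A\in M_K\}$. *)

(* Defs.v *)
From HB Require Import structures.
From mathcomp Require Import all_boot all_order all_algebra all_fingroup.
From mathcomp Require Import all_classical all_reals all_analysis.

Set Implicit Arguments.
Unset Strict Implicit.
Unset Printing Implicit Defensive.

Import Order.TTheory GRing.Theory Num.Theory.
Import numFieldNormedType.Exports.

Local Open Scope classical_set_scope.
Local Open Scope ring_scope.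

(* An index i in {1, ..., n} is the ordinal i - 1 : 'I_n.  The set            *)
(* {1, ..., n, -1, ..., -n} indexing the basis of R^2n is 'I_(n + n), with    *)
(* i = lshift n i and -i = rshift n i, in accordance with e_{-i} = e_{n+i}.   *)

Section Symplectic.
Variables (R : realType) (n : nat).

Definition Jmx : 'M[R]_(n + n) := block_mx 0 1%:M (- 1%:M) 0.

Definition Sp : set 'M[R]_(n + n) := [set g | g^T *m Jmx *m g = Jmx].

Definition upper_triangular (A : 'M[R]_n) : Prop :=
  forall i j : 'I_n, (j < i)%N -> A i j = 0.

Definition PJp : set 'M[R]_(n + n) := Sp `&` [set g | dlsubmx g = 0].

Definition Bp : set 'M[R]_(n + n) :=
  Sp `&` [set g | exists A B : 'M[R]_n,
    [/\ A \in unitmx, upper_triangular A & g = block_mx A B 0 (invmx A^T)]].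

Definition lower_unip (C : 'M[R]_n) : 'M[R]_(n + n) :=
  block_mx 1%:M 0 C 1%:M.

Definition symmetric (C : 'M[R]_n) : Prop := C^T = C.

Definition pos_semidef (C : 'M[R]_n) : Prop :=
  symmetric C /\ forall v : 'cV[R]_n, 0 <= (v^T *m C *m v) 0 0.

Definition UJm : set 'M[R]_(n + n) := [set lower_unip C | C in symmetric].

Definition UJm_ge0 : set 'M[R]_(n + n) :=
  [set lower_unip C | C in pos_semidef].

Definition double_coset (B P : set 'M[R]_(n + n)) (g : 'M[R]_(n + n)) :
    set 'M[R]_(n + n) :=
  [set x | exists b p, [/\ B b, P p & x = b *m g *m p]].

Definition diag_torus : set 'M[R]_(n + n) := Sp `&` [set g | is_diag_mx g].

Definition torus_normalizer : set 'M[R]_(n + n) :=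
  Sp `&` [set g | [set g *m d *m invmx g | d in diag_torus] = diag_torus].

Definition basis_vec (i : 'I_(n + n)) : 'cV[R]_(n + n) := delta_mx i 0.

Definition weyl_lift (w : {perm 'I_(n + n)}) (g : 'M[R]_(n + n)) : Prop :=
  torus_normalizer g /\
  forall i, g *m basis_vec i = basis_vec (w i) \/
            g *m basis_vec i = - basis_vec (w i).

Definition MK (K : {set 'I_n}) : set 'M[R]_n :=
  [set A | (forall i j : 'I_n, (i < j)%N \/ j \notin K -> A i j = 0) /\
           (forall k : 'I_n, k \in K -> 0 < A k k)].

Definition CK (K : {set 'I_n}) : set 'M[R]_n := [set A *m A^T | A in MK K].

End Symplectic.

Arguments Sp : clear implicits.
Arguments PJp : clear implicits.
Arguments Bp : clear implicits.
Arguments UJm : clear implicits.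
Arguments UJm_ge0 : clear implicits.
Arguments diag_torus : clear implicits.
Arguments torus_normalizer : clear implicits.
Arguments MK R {n} K _.
Arguments CK R {n} K _.

Section Weyl.
Variable n : nat.

Definition opp_idx (i : 'I_(n + n)) : 'I_(n + n) :=
  match fintype.split i with inl j => rshift n j | inr j => lshift n j end.

Definition weyl_group : {set {perm 'I_(n + n)}} :=
  [set w : {perm 'I_(n + n)} | [forall i, w (opp_idx i) == opp_idx (w i)]]%SET.

(* The product of the Weyl group is the composition of functions, s after t;  *)
(* the product of {perm T} in the library composes in the opposite order.     *)
Definition wmul (s t : {perm 'I_(n + n)}) : {perm 'I_(n + n)} := (t * s)%g.

(* The case None is that of the last index, i.e. s_n = t.                     *)
Definition simple_refl (i : 'I_n) : {perm 'I_(n + n)} :=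
  match (insub i.+1 : option 'I_n) with
  | Some j => wmul (tperm (lshift n i) (lshift n j))
                   (tperm (rshift n i) (rshift n j))
  | None => tperm (lshift n i) (rshift n i)
  end.

(* wK_factor k = s_k s_(k+1) ... s_(n-1) t                                    *)
Definition wK_factor (k : 'I_n) : {perm 'I_(n + n)} :=
  \big[wmul/1%g]_(i < n | (k <= i)%N) simple_refl i.

(* enum lists K in increasing order.                                          *)
Definition wK (K : {set 'I_n}) : {perm 'I_(n + n)} :=
  \big[wmul/1%g]_(k <- rev (enum K)) wK_factor k.

End Weyl.

Section Topology.

Definition is_connected_component (T : topologicalType) (Y C : set T) : Prop :=
  exists2 x, Y x & C = connected_component Y x.

Definition homeomorphic (T U : topologicalType) (A : set T) (B : set U) : Prop :=
  exists (f : T -> U) (g : U -> T),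
    [/\ (forall x, A x -> B (f x)) /\ (forall y, B y -> A (g y)),
        (forall x, A x -> g (f x) = x) /\ (forall y, B y -> f (g y) = y),
        {within A, continuous f} & {within B, continuous g}].

(* R_{>0}^a x R^b                                                             *)
Definition pos_orthant_prod (R : realType) (a b : nat) :
    set ('rV[R]_a * 'rV[R]_b) :=
  [set v : 'rV[R]_a * 'rV[R]_b | forall i, 0 < v.1 0 i].

End Topology.

Section Sanity.

Lemma opp_idxK n : involutive (@opp_idx n).
Proof.
move=> i; rewrite /opp_idx; case: (split_ordP i) => j -> ;
by [rewrite (unsplitK (inr j)) | rewrite (unsplitK (inl j))].
Qed.

Lemma opp_lshift n (i : 'I_n) : opp_idx (lshift n i) = rshift n i.
Proof. by rewrite /opp_idx (unsplitK (inl i)). Qed.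

Lemma opp_rshift n (i : 'I_n) : opp_idx (rshift n i) = lshift n i.
Proof. by rewrite /opp_idx (unsplitK (inr i)). Qed.

Lemma wmul_weyl n (s t : {perm 'I_(n + n)}) :
  s \in weyl_group n -> t \in weyl_group n -> wmul s t \in weyl_group n.
Proof.
rewrite !inE => /forallP hs /forallP ht; apply/forallP => i.
by rewrite !permM (eqP (ht i)) (eqP (hs _)).
Qed.

Lemma one_weyl n : 1%g \in weyl_group n.
Proof. by rewrite inE; apply/forallP => i; rewrite !perm1. Qed.

Lemma simple_refl_weyl n (i : 'I_n) : simple_refl i \in weyl_group n.
Proof.
pose o := perm (inv_inj (@opp_idxK n)).
suff h : (simple_refl i ^ o)%g = simple_refl i.
  rewrite inE; apply/forallP => x; rewrite -{1}h -[opp_idx x](permE (inv_inj (@opp_idxK n))).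
  by rewrite permJ [X in _ == X](_ : _ = o (simple_refl i x)) // permE.
have ol (k : 'I_n) : o (lshift n k) = rshift n k by rewrite permE opp_lshift.
have or (k : 'I_n) : o (rshift n k) = lshift n k by rewrite permE opp_rshift.
rewrite /simple_refl; case: insubP => [j _ _|_]; last by rewrite tpermJ ol or tpermC.
rewrite /wmul conjMg !tpermJ !ol !or.
apply: commgP; apply/conjg_fixP.
by rewrite tpermJ !tpermD // ?eq_lrshift // ?eq_rlshift.
Qed.

Lemma wK_weyl n (K : {set 'I_n}) : wK K \in weyl_group n.
Proof.
have wbig (I : Type) (r : seq I) (P : pred I) (F : I -> {perm 'I_(n + n)}) :
    (forall i, F i \in weyl_group n) ->
    \big[@wmul n/1%g]_(i <- r | P i) F i \in weyl_group n.
  by move=> hF; apply: (big_ind (fun w => w \in weyl_group n));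
    [exact: one_weyl | exact: wmul_weyl | move=> i _; exact: hF].
apply: (wbig _ _ predT) => k; apply: wbig => i; exact: simple_refl_weyl.
Qed.

Lemma Jmx_entry (R : realType) n (i j : 'I_(n + n)) :
  Jmx R n i j = (j == opp_idx i)%:R * (if (i < n)%N then 1 else -1).
Proof.
rewrite /Jmx; case: (split_ordP i) => a ->; case: (split_ordP j) => b ->;
  rewrite ?opp_lshift ?opp_rshift ?block_mxEul ?block_mxEur ?block_mxEdl
    ?block_mxEdr !mxE ?eq_lrshift ?eq_rlshift ?eq_lshift ?eq_rshift /=
    ?ltn_ord ?ltnNge ?leq_addr /= ?mul0r ?mulr1 ?mulrN1 ?oppr0 //;
  by rewrite eq_sym.
Qed.

Lemma weyl_lift_exists (R : realType) n (w : {perm 'I_(n + n)}) :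
  w \in weyl_group n -> exists g : 'M[R]_(n + n), weyl_lift w g.
Proof.
rewrite inE => /forallP hw.
have {}hw i : w (opp_idx i) = opp_idx (w i) by apply/eqP.
pose e (j : 'I_(n + n)) : R := if (j < n)%N then 1 else -1.
pose sg (j : 'I_(n + n)) : R :=
  if ~~ (j < n)%N && (w j < n)%N then -1 else 1.
have opp_lt (i : 'I_(n + n)) : (opp_idx i < n)%N = ~~ (i < n)%N.
  have hl (a : 'I_n) : (lshift n a < n)%N = true by exact: (ltn_ord a).
  have hr (a : 'I_n) : (rshift n a < n)%N = false.
    by apply/negbTE; rewrite -leqNgt leq_addr.
  by case: (split_ordP i) => a ->; rewrite ?opp_lshift ?opp_rshift ?hl ?hr.
pose M : 'M[R]_(n + n) := \matrix_(i, j) ((i == w j)%:R * sg j).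
have colM j : M *m basis_vec R j = sg j *: basis_vec R (w j).
  apply/colP => i; rewrite /basis_vec -colE !mxE andbT mulrC.
  by [].
have SpM : Sp R n M.
  rewrite /Sp /=; apply/matrixP => i j; rewrite mxE (bigD1 (w j)) //=.
  rewrite big1 ?addr0; last first.
    by move=> k /negbTE hk; rewrite [M _ _]mxE hk mul0r mulr0.
  rewrite mxE (bigD1 (w i)) //= big1 ?addr0; last first.
    by move=> k /negbTE hk; rewrite !mxE hk mul0r mul0r.
  rewrite !Jmx_entry !mxE !eqxx !mul1r -hw (inj_eq perm_inj) -/(e i) -/(e (w i)).
  case: eqP => [->|_]; last by rewrite !mul0r mulr0 mul0r.
  rewrite !mul1r /sg /e hw !opp_lt.
  by case: (i < n)%N; case: (w i < n)%N; rewrite /= ?mulr1 ?mul1r ?mulrNN ?mulr1.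
have Jsq : Jmx R n *m Jmx R n = - 1%:M.
  rewrite /Jmx mulmx_block !mul0mx !mulmx0 !mulmxN !mulNmx !mulmx1.
  by rewrite ?addr0 ?add0r scalar_mx_block opp_block_mx !oppr0.
have Junit : Jmx R n \in unitmx.
  have /mulmx1_unit[] // : Jmx R n *m (- Jmx R n) = 1%:M.
  by rewrite mulmxN Jsq opprK.
have Spunit g : Sp R n g -> g \in unitmx.
  rewrite /Sp /= => hg.
  have : (- Jmx R n) *m (g^T *m Jmx R n) *m g = 1%:M.
    by rewrite -mulmxA hg mulNmx Jsq opprK.
  by case/mulmx1_unit.
have SpV g : Sp R n g -> Sp R n (invmx g).
  move=> hg; have ug := Spunit _ hg.
  rewrite /Sp /= -{1}hg !mulmxA trmx_inv mulVmx ?unitmx_tr // mul1mx.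
  by rewrite -mulmxA mulmxV // mulmx1.
have SpMul g h : Sp R n g -> Sp R n h -> Sp R n (g *m h).
  rewrite /Sp /= => hg hh.
  by rewrite trmx_mul -[RHS]hh -[in RHS]hg !mulmxA.
have uM := Spunit _ SpM.
have diagM (f : 'rV[R]_(n + n)) :
    M *m diag_mx (\row_j f 0 (w j)) = diag_mx f *m M.
  apply/matrixP => i j; rewrite mul_mx_diag mul_diag_mx !mxE.
  by case: eqP => [->|_]; rewrite ?mul0r ?mulr0 // mulrC.
exists M; split; last first.
  move=> i; rewrite colM /sg; case: ifP => _; first by right; rewrite scaleN1r.
  by left; rewrite scale1r.
split => //=; apply/seteqP; split => [x [d [Spd /is_diag_mxP hd] <-]|d [Spd hd]].
  split; first by apply: (SpMul _ _ (SpMul _ _ _ _) (SpV _ _)).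
  have [f ->] := diag_mxP _ (introT (is_diag_mxP (A := d)) hd).
  pose f' : 'rV[R]_(n + n) := \row_j f 0 ((w^-1)%g j).
  rewrite (_ : diag_mx f = diag_mx (\row_j f' 0 (w j))); last first.
    by congr diag_mx; apply/rowP => j; rewrite !mxE permK.
  by rewrite diagM -mulmxA mulmxV // mulmx1 /=; exact: diag_mx_is_diag.
have [f df] := diag_mxP _ hd.
exists (invmx M *m d *m M); last first.
  by rewrite !mulmxA mulmxV // mul1mx -mulmxA mulmxV // mulmx1.
split; first by apply: (SpMul _ _ (SpMul _ _ (SpV _ _) _) _).
rewrite df -mulmxA -diagM mulmxA mulVmx // mul1mx /=; exact: diag_mx_is_diag.
Qed.

End Sanity.

(* Main.v *)
Require Import Defs.
From HB Require Import structures.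
From mathcomp Require Import all_boot all_order all_algebra all_fingroup.
From mathcomp Require Import all_classical all_reals all_analysis.
From mathcomp Require Import ring lra.

Set Implicit Arguments.
Unset Strict Implicit.
Unset Printing Implicit Defensive.

Import Order.TTheory GRing.Theory Num.Theory.
Import numFieldNormedType.Exports.

Local Open Scope classical_set_scope.
Local Open Scope ring_scope.

(** The left cosets of the parabolic subgroup correspond to Lagrangian subspaces,
    and the coset of [lower_unip C] to the graph of the symmetric form
    [C].  The only feature of [wK K] that matters is that it sends the span of
    [e_1, ..., e_n] to the coordinate Lagrangian spanned by the [e_j], [j] outside
    of [K], and the [e_{-k}], [k] in [K] (lemma [wK_pos]).  Comparing
    Lagrangians, if the graph of [C] lies in the cell of [K], then some upper
    triangular change of basis [A] makes [N = A^T C A] supported on [K x K] and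
    nondegenerate there ([coset_normal_form]); the converse is needed only when
    [N] is the coordinate projection of [K] ([normal_form_coset]).

    A positive semi-definite [C] has a Cholesky factorization [C = B B^T] with
    [B] in [MK R K'], where [K'] is the set of nonzero pivots of Gaussian
    elimination ([choleskyP], [cholesky_MK]).  Looking at diagonal entries and
    ranks, a matrix which also has the normal form of [K] satisfies [K' = K]
    ([psd_normal_form_CK]).  Conversely each element of [CK R K] has the normal
    form with [N] the coordinate projection of [K].  This describes the
    nonnegative part of the cell.

    It is connected because [MK R K] is convex.  It is open and closed in the
    cell: closedness is clear, and on the cell the rank is at most [#|K|], so a
    form of the cell which is positive definite on some [#|K|]-dimensional space,
    an open condition, is positive semi-definite, since this space and the kernel
    of the form span everything ([psd_of_posdef_on]).

    Finally, the Cholesky factor is unique ([choleskyK]) and depends continuously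
    on the matrix within [CK R K] ([cvg_cholesky]), so that [CK R K] is
    homeomorphic to [MK R K], whose free entries are the positive diagonal ones
    in the columns of [K] and those below them. *)

(** * The Weyl group element of a set of indices *)

Section WeylElement.
Variable n : nat.
Implicit Types (i j k : 'I_n) (s t : {perm 'I_(n + n)}).

Lemma wmulE s t (x : 'I_(n + n)) : wmul s t x = s (t x).
Proof. by rewrite /wmul permM. Qed.

(* Makes the lemmas on iterated monoid laws available for [wmul]. *)
HB.instance Definition _ := Monoid.isLaw.Build {perm 'I_(n + n)} 1%g (@wmul n)
  (fun s t u => esym (mulgA u t s)) (@mulg1 _) (@mul1g _).

Lemma simple_reflE i j : j = i.+1 :> nat ->
  simple_refl i = wmul (tperm (lshift n i) (lshift n j))
                       (tperm (rshift n i) (rshift n j)).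
Proof.
move=> ji; rewrite /simple_refl; case: insubP => [j' _ hj'|].
  by have -> : j' = j by apply: val_inj; rewrite /= hj' ji.
by rewrite -ji ltn_ord.
Qed.

Lemma simple_refl_last i : i.+1 = n ->
  simple_refl i = tperm (lshift n i) (rshift n i).
Proof.
move=> hi; rewrite /simple_refl; case: insubP => // j.
by rewrite hi ltnn.
Qed.

(** The reflection [s_i] fixes [j] and [-j] for [j < i]; the boolean selects
    the sign. *)
Lemma simple_refl_fix i j (b : bool) : (j < i)%N ->
  simple_refl i (if b then lshift n j else rshift n j) =
  if b then lshift n j else rshift n j.
Proof.
move=> ji.
have nij : j != i by rewrite -val_eqE neq_ltn ji.
have nS (l : 'I_n) : l = i.+1 :> nat -> j != l.
  by move=> hl; rewrite -val_eqE /= hl neq_ltn (ltn_trans ji).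
case: (ltnP i.+1 n) => [hi|hi].
  rewrite (@simple_reflE i (Ordinal hi)) // wmulE.
  have {}nS := nS (Ordinal hi) erefl.
  by case: b; rewrite !tpermD // ?(eq_lshift, eq_rshift, eq_lrshift, eq_rlshift)
    // eq_sym.
rewrite simple_refl_last; last by apply/eqP; rewrite eqn_leq ltn_ord.
by case: b; rewrite tpermD // ?(eq_lshift, eq_rshift, eq_lrshift, eq_rlshift)
    // eq_sym.
Qed.

Lemma wK_factor_fix k j (b : bool) : (j < k)%N ->
  wK_factor k (if b then lshift n j else rshift n j) =
  if b then lshift n j else rshift n j.
Proof.
move=> jk; set x := if b then _ else _.
rewrite /wK_factor; apply: (big_ind (fun s : {perm 'I_(n + n)} => s x = x)).
- by rewrite perm1.
- by move=> s t hs ht; rewrite wmulE ht.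
- by move=> i ki; rewrite simple_refl_fix // (leq_trans jk).
Qed.

(* The simple reflections indexed by natural numbers, in order to peel off the
   first factor of a product over an interval. *)
Let refl_nat (m : nat) : {perm 'I_(n + n)} :=
  if insub m is Some i then simple_refl i else 1%g.

Let wK_factor_nat k : wK_factor k = \big[@wmul n/1%g]_(k <= m < n) refl_nat m.
Proof.
rewrite big_geq_mkord; apply: eq_bigr => i _.
rewrite /refl_nat; case: insubP => [j _ hj|]; last by rewrite ltn_ord.
by have -> : j = i by apply: val_inj.
Qed.

Let wK_factor_last k : k.+1 = n -> wK_factor k = simple_refl k.
Proof.
move=> hk; rewrite wK_factor_nat big_ltn // big_geq ?hk //.
rewrite /refl_nat; case: insubP => [j _ hj|]; last by rewrite ltn_ord.
have -> : j = k by apply: val_inj.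
by apply/permP => x; rewrite wmulE perm1.
Qed.

Let wK_factorS k j : j = k.+1 :> nat ->
  wK_factor k = wmul (simple_refl k) (wK_factor j).
Proof.
move=> jk; rewrite !wK_factor_nat big_ltn // -jk.
rewrite {1}/refl_nat; case: insubP => [i _ hi|]; last by rewrite ltn_ord.
by have -> : i = k by apply: val_inj.
Qed.

(** The factor of [k] sends a positive index [j >= k] to [-k] (when [j] is the
    last index) or to a positive index greater than [k]. *)
Lemma wK_factor_ge k j : (k <= j)%N ->
  wK_factor k (lshift n j) = rshift n k \/
  exists2 j' : 'I_n, (k < j')%N & wK_factor k (lshift n j) = lshift n j'.
Proof.
have [d] := ubnP (n - k)%N; elim: d k j => // d IH k j hd kj.
case: (ltnP k.+1 n) => hk; last first.
  have {}hk : k.+1 = n by apply/eqP; rewrite eqn_leq ltn_ord.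
  have -> : j = k.
    by apply: val_inj; apply/eqP; rewrite eqn_leq kj -ltnS hk ltn_ord.
  by left; rewrite wK_factor_last // simple_refl_last // tpermL.
pose l := Ordinal hk.
rewrite (@wK_factorS k l) // wmulE (@simple_reflE k l) // wmulE.
case: (ltnP k j) => [kj'|jk]; last first.
  have -> : j = k by apply: val_inj; apply/eqP; rewrite eqn_leq jk kj.
  right; exists l => //.
  rewrite (@wK_factor_fix l k true) // (tpermD (z := lshift n k)) ?eq_rlshift //.
  by rewrite tpermL.
have [] := IH l j _ kj'.
- by move: hd; rewrite ltnS => /(leq_trans _); apply; rewrite subnS prednK // subn_gt0.
- move=> ->; left; rewrite tpermR tpermD ?eq_lrshift //.
- case=> j' lj' ->; right; exists j'; first exact: ltn_trans lj'.
  have h1 : l != j' by rewrite -val_eqE neq_ltn lj'.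
  have h2 : k != j' by rewrite -val_eqE neq_ltn (ltn_trans _ lj').
  by rewrite (tpermD (z := lshift n j')) ?eq_rlshift // tpermD // eq_lshift.
Qed.

(** The coordinate Lagrangian attached to [wK K]: its basis vectors have indices
    [j] for [j] outside of [K] and [-k] for [k] in [K]. *)
Lemma wK_pos (K : {set 'I_n}) i :
  (exists2 j, j \notin K & wK K (lshift n i) = lshift n j) \/
  (exists2 k, k \in K & wK K (lshift n i) = rshift n k).
Proof.
suff h (s : seq 'I_n) : sorted (fun x y : 'I_n => (y < x)%N) s ->
  (exists2 j, j \notin s &
    (\big[@wmul n/1%g]_(k <- s) wK_factor k) (lshift n i) = lshift n j) \/
  (exists2 k, k \in s &
    (\big[@wmul n/1%g]_(k <- s) wK_factor k) (lshift n i) = rshift n k).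
  have := h (rev (enum K)); rewrite -/(wK K) rev_sorted.
  have -> : sorted (fun x y : 'I_n => (x < y)%N) (enum K).
    rewrite {1}/enum_mem -enumT sorted_filter //.
      by move=> x y z; apply: ltn_trans.
    rewrite -(@sorted_map _ _ val ltn) val_enum_ord; exact: iota_ltn_sorted.
  case=> // [] [j hj ->]; [left|right]; exists j => //; move: hj;
    by rewrite mem_rev mem_enum.
(* The factors are applied in increasing order of [k]: the factor of [k] keeps
   the indices [-j] and [j] with [j < k], and sends the other positive ones to
   [-k] or to positive indices greater than [k]. *)
elim: s => [|k s IH] hs; first by left; exists i => //; rewrite big_nil perm1.
have ks x : x \in s -> (x < k)%N.
  move=> xs; move: hs; rewrite /= path_sortedE; last first.
    by move=> a b c /= ba cb; exact: ltn_trans cb ba.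
  by case/andP => /allP /(_ _ xs).
rewrite big_cons wmulE; case: (IH (path_sorted hs)) => [] [j js ->].
  case: (ltnP j k) => jk.
    left; exists j; last by rewrite (@wK_factor_fix k j true).
    by rewrite inE negb_or js andbT -val_eqE neq_ltn jk.
  case: (wK_factor_ge jk) => [->|[j' kj' ->]].
    by right; exists k; rewrite ?mem_head.
  left; exists j' => //; rewrite inE negb_or -val_eqE neq_ltn kj' orbT /=.
  by apply/negP => /ks; rewrite ltnNge (ltnW kj').
right; exists j; first by rewrite inE js orbT.
by rewrite (@wK_factor_fix k j false) // ks.
Qed.

End WeylElement.

(** * The double coset and its normal form *)

Section Projections.
Variables (R : realType) (n : nat).
Implicit Types (A B C : 'M[R]_n) (K : {set 'I_n}).

(** The coordinate projection of [R^n] onto the span of the [e_k], [k] in [K]. *)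
Definition coord_proj K : 'M[R]_n := diag_mx (\row_j (j \in K)%:R).

Lemma mul_coord_proj m (A : 'M[R]_(m, n)) K i j :
  (A *m coord_proj K) i j = if j \in K then A i j else 0.
Proof. by rewrite mul_mx_diag !mxE; case: (j \in K); rewrite ?mulr1 ?mulr0. Qed.

Lemma coord_projE K i j : coord_proj K i j = ((i == j) && (j \in K))%:R.
Proof.
rewrite -[coord_proj K]mul1mx mul_coord_proj mxE.
by case: (j \in K); rewrite ?andbT ?andbF.
Qed.

Lemma tr_coord_proj K : (coord_proj K)^T = coord_proj K.
Proof. exact: tr_diag_mx. Qed.

Lemma coord_projK K : coord_proj K *m coord_proj K = coord_proj K.
Proof.
by apply/matrixP => i j; rewrite mul_coord_proj coord_projE; case: (j \in K); rewrite ?andbF.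
Qed.

Lemma coord_proj_compl K : coord_proj K *m coord_proj (~: K) = 0.
Proof.
apply/matrixP => i j; rewrite mul_coord_proj coord_projE !mxE inE.
by case: (j \in K); rewrite ?andbF.
Qed.

Lemma coord_projD K : coord_proj (~: K) + coord_proj K = 1%:M.
Proof.
apply/matrixP => i j; rewrite mxE !coord_projE !mxE inE.
by case: (j \in K); rewrite ?andbF ?andbT ?addr0 ?add0r.
Qed.

(** [proj_lagr K] has as columns a basis of the coordinate Lagrangian spanned by
    [e_j], [j] outside of [K], and [e_{-k}], [k] in [K]. *)
Definition proj_lagr K : 'M[R]_(n + n, n) := col_mx (coord_proj (~: K)) (coord_proj K).

(** The Lagrangian of the base point, i.e. the span of [e_1, ..., e_n]. *)
Definition std_lagr : 'M[R]_(n + n, n) := col_mx 1%:M 0.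

Lemma proj_lagr_in K (j : 'I_n) : j \notin K ->
  proj_lagr K *m delta_mx j 0 = basis_vec R (lshift n j).
Proof.
move=> jK; apply/colP => i; rewrite /basis_vec -colE !mxE.
case: (split_ordP i) => a ->; rewrite ?coord_projE ?inE ?eq_lshift ?eq_rlshift.
  by rewrite jK.
by rewrite (negbTE jK) andbF.
Qed.

Lemma proj_lagr_out K (j : 'I_n) : j \in K ->
  proj_lagr K *m delta_mx j 0 = basis_vec R (rshift n j).
Proof.
move=> jK; apply/colP => i; rewrite /basis_vec -colE !mxE.
case: (split_ordP i) => a ->; rewrite ?coord_projE ?inE ?eq_rshift ?eq_lrshift.
  by rewrite jK andbF.
by rewrite jK.
Qed.

End Projections.

Section SymplecticGroup.
Variables (R : realType) (n : nat).
Implicit Types (g h : 'M[R]_(n + n)).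

Lemma Jmx_sqr : Jmx R n *m Jmx R n = - 1%:M.
Proof.
rewrite /Jmx mulmx_block !mul0mx !mulmx0 !mulmxN !mulNmx !mulmx1.
by rewrite ?addr0 ?add0r scalar_mx_block opp_block_mx !oppr0.
Qed.

Lemma Sp_unit g : Sp R n g -> g \in unitmx.
Proof.
rewrite /Sp /= => hg.
have : (- Jmx R n) *m (g^T *m Jmx R n) *m g = 1%:M.
  by rewrite -mulmxA hg mulNmx Jmx_sqr opprK.
by case/mulmx1_unit.
Qed.

Lemma Sp_inv g : Sp R n g -> Sp R n (invmx g).
Proof.
move=> hg; have ug := Sp_unit hg.
rewrite /Sp /= -{1}hg !mulmxA trmx_inv mulVmx ?unitmx_tr // mul1mx.
by rewrite -mulmxA mulmxV // mulmx1.
Qed.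

Lemma Sp_mul g h : Sp R n g -> Sp R n h -> Sp R n (g *m h).
Proof.
rewrite /Sp /= => hg hh.
by rewrite trmx_mul -[RHS]hh -[in RHS]hg !mulmxA.
Qed.

(** The symplectic condition for a block matrix, entry by entry. *)
Lemma Sp_block (A B C D : 'M[R]_n) :
  Sp R n (block_mx A B C D) <->
  [/\ A^T *m C = C^T *m A, A^T *m D - C^T *m B = 1%:M,
      B^T *m C - D^T *m A = - 1%:M & B^T *m D = D^T *m B].
Proof.
rewrite /Sp /= /Jmx tr_block_mx !mulmx_block.
rewrite !mulmx0 !mulmxN !mulmx1 !add0r !addr0 !mulNmx.
rewrite ![- _ + _]addrC; split.
  case/eq_block_mx => h1 h2 h3 h4; split=> //; apply/eqP; rewrite -subr_eq0;
    exact/eqP.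
by case=> -> -> -> ->; rewrite !subrr.
Qed.

Lemma Sp_lower_unip (C : 'M[R]_n) : Defs.symmetric C -> Sp R n (lower_unip C).
Proof.
move=> sC; apply/Sp_block; rewrite trmx1 sC trmx0 !mul1mx !mulmx1 !mul0mx !mulmx0.
by rewrite subr0 sub0r.
Qed.

End SymplecticGroup.

Section Triangular.
Variables (R : realType) (n : nat).
Implicit Types (A L : 'M[R]_n).

Lemma trig_unitmx L : is_trig_mx L -> (L \in unitmx) = [forall i, L i i != 0].
Proof.
by move=> tL; rewrite unitmxE det_trig // unitfE; apply/prodf_neq0/forallP => h i;
  move: (h i) => // /(_ isT).
Qed.

Lemma trig_mulmx_diag A L i : is_trig_mx A -> is_trig_mx L ->
  (A *m L) i i = A i i * L i i.
Proof.
move=> /is_trig_mxP tA /is_trig_mxP tL; rewrite mxE (bigD1 i) //= big1 ?addr0 //.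
move=> k; rewrite -val_eqE neq_ltn => /orP[] h; first by rewrite tL ?mulr0.
by rewrite tA ?mul0r.
Qed.

Lemma trig_invmx L : L \in unitmx -> is_trig_mx L -> is_trig_mx (invmx L).
Proof.
move=> uL tL; apply/is_trig_mxP => i j.
have /forallP dL : [forall i, L i i != 0] by rewrite -trig_unitmx.
have [m] := ubnP (i : nat); elim: m i j => // m IH i j im ij.
have /matrixP /(_ i j) := mulmxV uL.
rewrite !mxE (bigD1 i) //= big1 ?addr0; last first.
  move=> k; rewrite -val_eqE neq_ltn => /orP[] h.
    rewrite IH ?mulr0 //; [exact: leq_trans h im | exact: ltn_trans h ij].
  by rewrite (is_trig_mxP tL) ?mul0r.
rewrite -val_eqE /= (ltn_eqF ij) => /eqP; rewrite mulf_eq0 (negbTE (dL i)) /=.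
by move/eqP.
Qed.

Lemma upper_triangular_tr A : upper_triangular A <-> is_trig_mx A^T.
Proof.
split=> [h|/is_trig_mxP h i j ij]; last by have := h _ _ ij; rewrite mxE.
by apply/is_trig_mxP => i j ij; rewrite mxE h.
Qed.

End Triangular.

(** [C] is congruent, by a lower triangular invertible matrix, to a matrix [N]
    supported on the columns in [K] and nondegenerate on [K]; there [S] is the
    inverse of [N]. *)
Definition has_normal_form (R : realType) n (K : {set 'I_n}) (C : 'M[R]_n) :=
  exists A S : 'M[R]_n, let N := A^T *m C *m A in
  [/\ A \in unitmx, is_trig_mx A^T, N *m coord_proj R K = N
    & N *m S *m coord_proj R K = coord_proj R K].

Section DoubleCoset.
Variables (R : realType) (n : nat) (K : {set 'I_n}) (W : 'M[R]_(n + n)).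
Hypothesis hW : weyl_lift (wK K) W.

Let spW : Sp R n W. Proof. by case: hW => [[]]. Qed.

Lemma weyl_lift_lagr :
  exists2 Q : 'M[R]_n, Q \in unitmx & W *m std_lagr R n = proj_lagr R K *m Q.
Proof.
have hq (i : 'I_n) : exists q : 'cV[R]_n,
    W *m basis_vec R (lshift n i) = proj_lagr R K *m q.
  have [w0|w0] := hW.2 (lshift n i); rewrite {}w0;
    case: (wK_pos K i) => [] [j jK ->].
  - by exists (delta_mx j 0); rewrite proj_lagr_in.
  - by exists (delta_mx j 0); rewrite proj_lagr_out.
  - by exists (- delta_mx j 0); rewrite mulmxN proj_lagr_in.
  - by exists (- delta_mx j 0); rewrite mulmxN proj_lagr_out.
have [q hq'] := choice hq.
pose Q : 'M[R]_n := \matrix_(i, j) q j i 0.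
have WQ : W *m std_lagr R n = proj_lagr R K *m Q.
  apply/matrixP => i j.
  transitivity ((W *m basis_vec R (lshift n j)) i 0).
    rewrite /basis_vec -colE [RHS]mxE [LHS]mxE (bigD1 (lshift n j)) //=.
    rewrite big1 ?addr0 => [|k]; first by rewrite col_mxEu mxE eqxx mulr1.
    case: (split_ordP k) => a -> h'; last by rewrite col_mxEd mxE mulr0.
    by rewrite col_mxEu mxE; move: h'; rewrite eq_lshift => /negbTE ->; rewrite mulr0.
  by rewrite hq' !mxE; apply: eq_bigr => k _; rewrite [Q _ _]mxE.
exists Q => //.
have : row_mx 1%:M 0 *m invmx W *m proj_lagr R K *m Q = 1%:M.
  rewrite -mulmxA -WQ mulmxA -[X in X *m _]mulmxA mulVmx ?Sp_unit // mulmx1.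
  by rewrite mul_row_col mulmx1 mulmx0 addr0.
by case/mulmx1_unit.
Qed.

(** Applying both sides of [lower_unip C = b W p] to the Lagrangian of the base
    point gives a system for the blocks [A] and [B] of [b], in which the matrix
    [A^-1 B] is the inverse of [A^T C A] on [K]. *)
Lemma coset_normal_form (C : 'M[R]_n) : Defs.symmetric C ->
  double_coset (Bp R n) (PJp R n) W (lower_unip C) ->
  has_normal_form K C.
Proof.
move=> sC [b [p [[spb [A [B [uA /upper_triangular_tr tA bE]]]] [spp pE] hC]]].
have [Q uQ WQ] := weyl_lift_lagr.
have pL : p *m std_lagr R n = std_lagr R n *m ulsubmx p.
  rewrite -{1}[p]submxK (pE : dlsubmx p = 0) mul_block_col mul_col_mx.
  by rewrite !mulmx0 !mulmx1 mul1mx mul0mx !addr0.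
pose Z := Q *m ulsubmx p.
have : lower_unip C *m std_lagr R n = b *m proj_lagr R K *m Z.
  by rewrite hC -mulmxA pL !mulmxA -[b *m W *m _]mulmxA WQ !mulmxA.
rewrite bE /lower_unip !mul_block_col mul_col_mx !mulmx1 !mulmx0 !addr0 mul0mx add0r.
set X := A *m _ + _ => /eq_col_mx[XZ CZ].
have [uX uZ] := mulmx1_unit (esym XZ).
have CX : C *m X = invmx A^T *m coord_proj R K.
  by rewrite CZ -mulmxA (mulmx1C (esym XZ)) mulmx1.
pose S := invmx A *m B.
have sS : S^T = S.
  move: spb; rewrite bE => /Sp_block[_ _ _].
  rewrite /S trmx_mul !trmx_inv trmxK => h; exact: h.
have XE : X = A *m (coord_proj R (~: K) + S *m coord_proj R K).
  by rewrite mulmxDr /S !mulmxA mulmxV // mul1mx.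
exists A, S => /=; set N := A^T *m C *m A.
have NX : N *m (coord_proj R (~: K) + S *m coord_proj R K) = coord_proj R K.
  by rewrite /N -mulmxA -XE -mulmxA CX mulmxA mulmxV ?mul1mx // unitmx_tr.
have NC : N *m coord_proj R (~: K) = 0.
  have := congr1 (mulmx^~ (coord_proj R (~: K))) NX.
  rewrite /= -mulmxA mulmxDl -[S *m _ *m _]mulmxA coord_proj_compl mulmx0 addr0.
  by rewrite coord_projK.
split=> //.
  by rewrite -[RHS]mulmx1 -(coord_projD R K) mulmxDr NC add0r.
by move: NX; rewrite mulmxDr NC add0r mulmxA.
Qed.

(** Conversely, the forms [L D L^T] with [L] lower triangular invertible and [D]
    the projection of [K] lie in the double coset: the factor in the Borel
    subgroup is [[U, U D], [0, L]] with [U] the inverse transpose of [L]. *)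
Lemma normal_form_coset (L : 'M[R]_n) : L \in unitmx -> is_trig_mx L ->
  double_coset (Bp R n) (PJp R n) W (lower_unip (L *m coord_proj R K *m L^T)).
Proof.
move=> uL tL; set D := coord_proj R K; set C := L *m D *m L^T.
have [Q uQ WQ] := weyl_lift_lagr.
have sC : Defs.symmetric C by rewrite /Defs.symmetric /C !trmx_mul trmxK tr_coord_proj mulmxA.
pose U := invmx L^T; pose b := block_mx U (U *m D) 0 L.
have uU : U \in unitmx by rewrite unitmx_inv unitmx_tr.
have UT : U^T = invmx L by rewrite /U trmx_inv trmxK.
have spb : Sp R n b.
  apply/Sp_block; rewrite trmx0 !mulmx0 !mul0mx subr0 sub0r UT mulVmx //.
  split=> //; first by rewrite /U mulmxV // unitmx_tr.
  rewrite trmx_mul UT tr_coord_proj -mulmxA mulVmx // mulmx1.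
  by rewrite /U mulmxA mulmxV ?unitmx_tr // mul1mx.
pose p := invmx W *m invmx b *m lower_unip C.
have [ub uW] : b \in unitmx /\ W \in unitmx by split; exact: Sp_unit.
exists b, p; split.
- split=> //; exists U, (U *m D); split=> //.
    by apply/upper_triangular_tr; rewrite UT trig_invmx.
  by rewrite UT invmxK.
- split; first by apply: Sp_mul; [apply: Sp_mul; exact: Sp_inv | exact: Sp_lower_unip].
  have bL : b *m proj_lagr R K = lower_unip C *m std_lagr R n *m U.
    rewrite /b /lower_unip !mul_block_col !mulmx1 !mulmx0 !addr0 mul0mx add0r.
    rewrite mul_col_mx mul1mx -[U *m D *m _]mulmxA coord_projK -mulmxDr coord_projD.
    by rewrite mulmx1 /C /U -mulmxA mulmxV ?mulmx1 // unitmx_tr.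
  have pL : p *m std_lagr R n = std_lagr R n *m (invmx Q *m invmx U).
    rewrite mulmxA -[std_lagr _ _ in RHS](mulKmx uW) WQ !mulmxA mulmxK //.
    rewrite -[proj_lagr _ _](mulKmx ub) bL !mulmxA mulmxK //.
  rewrite /=; move: pL; rewrite -{1}[p]submxK mul_block_col mul_col_mx.
  by rewrite !mulmx0 !mulmx1 mul0mx !addr0 => /eq_col_mx[].
- by rewrite /p !mulmxA mulmxK // mulmxV // mul1mx.
Qed.

End DoubleCoset.

(** * Quadratic forms and the Cholesky factorization *)

Section QuadraticForm.
Variables (R : realType) (n : nat).
Implicit Types (C E : 'M[R]_n) (u v w : 'cV[R]_n).

(** The bilinear form with matrix [E]. *)
Definition bform E u v : R := (u^T *m E *m v) 0 0.

Lemma bformDl E u v w : bform E (u + v) w = bform E u w + bform E v w.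
Proof. by rewrite /bform linearD /= !mulmxDl mxE. Qed.

Lemma bformDr E u v w : bform E u (v + w) = bform E u v + bform E u w.
Proof. by rewrite /bform mulmxDr mxE. Qed.

Lemma bformZl E a u v : bform E (a *: u) v = a * bform E u v.
Proof. by rewrite /bform linearZ /= -!scalemxAl mxE. Qed.

Lemma bformZr E a u v : bform E u (a *: v) = a * bform E u v.
Proof. by rewrite /bform -scalemxAr mxE. Qed.

Lemma bformC E u v : Defs.symmetric E -> bform E u v = bform E v u.
Proof.
move=> sE; rewrite /bform.
have -> : u^T *m E *m v = (v^T *m E *m u)^T by rewrite !trmx_mul trmxK sE mulmxA.
by rewrite mxE.
Qed.

Lemma bform_deltal E i v : bform E (delta_mx i 0) v = (row i E *m v) 0 0.
Proof. by rewrite /bform trmx_delta -rowE. Qed.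

Lemma bform_delta E i j : bform E (delta_mx i 0) (delta_mx j 0) = E i j.
Proof. by rewrite bform_deltal -colE !mxE. Qed.

Lemma bform_congr E (A : 'M[R]_n) u v :
  bform (A^T *m E *m A) u v = bform E (A *m u) (A *m v).
Proof. by rewrite /bform trmx_mul !mulmxA. Qed.

Lemma bformE E u v : bform E u v = \sum_i \sum_j u i 0 * v j 0 * E i j.
Proof.
rewrite /bform !mxE exchange_big /=; apply: eq_bigr => j _.
rewrite mxE mulr_suml; apply: eq_bigr => i _; rewrite mxE; ring.
Qed.

Lemma gram_psd (A : 'M[R]_n) : pos_semidef (A *m A^T).
Proof.
split=> [|v]; first by rewrite /Defs.symmetric trmx_mul trmxK.
have -> : v^T *m (A *m A^T) *m v = (A^T *m v)^T *m (A^T *m v).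
  by rewrite trmx_mul trmxK !mulmxA.
by rewrite mxE sumr_ge0 // => i _; rewrite mxE -expr2 sqr_ge0.
Qed.

Lemma psd_congr E (A : 'M[R]_n) : pos_semidef E -> pos_semidef (A^T *m E *m A).
Proof.
case=> sE pE; split=> [|v]; first by rewrite /Defs.symmetric !trmx_mul trmxK sE mulmxA.
by rewrite -/(bform _ v v) bform_congr; exact: pE.
Qed.

Lemma psd_diag_ge0 E i : pos_semidef E -> 0 <= E i i.
Proof. by case=> _ /(_ (delta_mx i 0)); rewrite -/(bform _ _ _) bform_delta. Qed.

Lemma psd_diag0 E i k : pos_semidef E -> E k k = 0 -> E i k = 0.
Proof.
move=> [sE pE] k0; apply/eqP/negPn/negP => ik0.
(* For this [t] the form takes the value [-1] at [e_i + t e_k]. *)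
pose t := - (E i i + 1) / (2 * E i k).
have := pE (delta_mx i 0 + t *: delta_mx k 0); rewrite -/(bform _ _ _).
rewrite bformDl !bformDr !bformZl !bformZr !bform_delta k0 !mulr0 addr0.
rewrite [E k i](_ : _ = E i k); last by rewrite -[in RHS]sE mxE.
have -> : E i i + t * E i k + t * E i k = - 1 by rewrite /t; field.
by rewrite oppr_ge0 ler10.
Qed.

End QuadraticForm.

Section Cholesky.
Variables (R : realType) (n : nat).
Implicit Types (A C E : 'M[R]_n) (K : {set 'I_n}).

(** Schur complement of the entry [(k, k)].  With the convention [0^-1 = 0], it
    is [E] itself when the pivot [E k k] vanishes. *)
Definition schur (k : 'I_n) E : 'M[R]_n :=
  E - (E k k)^-1 *: (col k E *m row k E).

Lemma schurE k E i j : schur k E i j = E i j - (E k k)^-1 * (E i k * E k j).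
Proof. by rewrite /schur !mxE big_ord1 !mxE. Qed.

Lemma schur_psd k E : pos_semidef E -> pos_semidef (schur k E).
Proof.
move=> [sE pE]; have EC i j : E i j = E j i by rewrite -[in LHS]sE mxE.
split=> [|v].
  apply/matrixP => i j; rewrite mxE !schurE [E j i]EC [E j k]EC [E k i]EC.
  by rewrite [E k j * _]mulrC.
pose e : 'cV[R]_n := delta_mx k 0; pose t := (E k k)^-1 * bform E e v.
rewrite -/(bform _ v v).
have -> : bform (schur k E) v v = bform E v v - (E k k)^-1 * (bform E e v) ^+ 2.
  rewrite /bform /schur mulmxBr mulmxBl mxE; congr (_ + _).
  rewrite mxE -scalemxAr -scalemxAl mxE; congr (- (_ * _)).
  rewrite -/(bform E e v) expr2 {1}bformC // bform_deltal /bform colE !mulmxA.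
  by rewrite -[_ *m row k E *m v]mulmxA mxE big_ord1.
case: (eqVneq (E k k) 0) => [->|Ek]; first by rewrite invr0 mul0r subr0; exact: pE.
(* The Schur complement at [v] is [E] at the projection of [v] along [e]. *)
have := pE (v + (- t) *: e); rewrite -/(bform _ _ _).
rewrite bformDl !bformDr !bformZl !bformZr [bform E v e]bformC // bform_delta.
by congr (0 <= _); rewrite /t; field.
Qed.

(** Symmetric Gaussian elimination of the first [m] pivots. *)
Fixpoint schur_iter (m : nat) C : 'M[R]_n :=
  if m is m'.+1 then
    if insub m' is Some k then schur k (schur_iter m' C) else schur_iter m' C
  else C.

Lemma schur_iterS (k : 'I_n) C :
  schur_iter k.+1 C = schur k (schur_iter k C).
Proof.
rewrite /=; case: insubP => [j _ hj|]; last by rewrite ltn_ord.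
by have -> : j = k by apply: val_inj.
Qed.

(** The Cholesky factor of [C].  A zero pivot gives a zero column. *)
Definition cholesky C : 'M[R]_n :=
  \matrix_(i, k) (schur_iter k C i k / Num.sqrt (schur_iter k C k k)).

Section Semidefinite.
Variables (C : 'M[R]_n) (pC : pos_semidef C).

Lemma schur_iter_psd m : pos_semidef (schur_iter m C).
Proof. by elim: m => //= m IH; case: insub => // k; exact: schur_psd. Qed.

Lemma schur_iter0 m (i j : 'I_n) : (m <= n)%N -> (i < m)%N || (j < m)%N ->
  schur_iter m C i j = 0.
Proof.
elim: m i j => [|m IH] i j mn; first by rewrite !ltn0.
have psdC := schur_iter_psd m.
pose k := Ordinal mn; rewrite (schur_iterS k) schurE /=.
have EC a b : schur_iter m C a b = schur_iter m C b a by rewrite -{1}psdC.1 mxE.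
have h (a b : 'I_n) : (a < m.+1)%N ->
    schur_iter m C a b -
      (schur_iter m C k k)^-1 * (schur_iter m C a k * schur_iter m C k b) = 0.
  rewrite ltnS leq_eqVlt => /orP[/eqP am|am]; last first.
    by rewrite (IH a b) ?(IH a k) ?am ?(ltnW mn) // mul0r mulr0 subrr.
  have -> : a = k by apply: val_inj.
  case: (eqVneq (schur_iter m C k k) 0) => [k0|k0].
    by rewrite k0 invr0 mul0r subr0 EC psd_diag0.
  by rewrite mulKf // subrr.
case/orP; first exact: h.
move=> /h -/(_ i); rewrite EC [X in _ * (X * _)]EC [X in _ * (_ * X)]EC.
by rewrite [X in _ * X]mulrC.
Qed.

Lemma cholesky_trig (i j : 'I_n) : (i < j)%N -> cholesky C i j = 0.
Proof.
by move=> ij; rewrite mxE schur_iter0 ?ij ?mul0r // ltnW.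
Qed.

Lemma cholesky_partial m (i j : 'I_n) : (m <= n)%N ->
  C i j = \sum_(k < n | (k < m)%N) cholesky C i k * cholesky C j k
          + schur_iter m C i j.
Proof.
elim: m => [|m IH] mn; first by rewrite big_pred0 ?add0r.
have psdC := schur_iter_psd m.
pose k := Ordinal mn.
rewrite (schur_iterS k) schurE (bigD1 k) //=.
rewrite (eq_bigl (fun k : 'I_n => (k < m)%N)); last first.
  by move=> a /=; rewrite -val_eqE /= ltnS leq_eqVlt; case: ltngtP.
rewrite {1}(IH (ltnW mn)) -addrA addrCA; congr (_ + _).
rewrite !mxE /=.
rewrite [schur_iter m C k j](_ : _ = schur_iter m C j k); last by rewrite -{1}psdC.1 mxE.
set s := Num.sqrt _; set E := schur_iter m C.
have -> : E i k / s * (E j k / s) = (s ^+ 2)^-1 * (E i k * E j k).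
  by rewrite expr2 invfM; ring.
by rewrite sqr_sqrtr ?psd_diag_ge0 // addrC subrK.
Qed.

Lemma choleskyP : C = cholesky C *m (cholesky C)^T.
Proof.
apply/matrixP => i j; rewrite (cholesky_partial i j (leqnn n)).
rewrite schur_iter0 ?ltn_ord // addr0 mxE; apply: eq_big => k; first by rewrite ltn_ord.
by rewrite [_^T _ _]mxE.
Qed.

(** Every positive semi-definite matrix lies in some [CK R K]: its Cholesky
    factor lies in [MK R K] for [K] the set of nonzero pivots. *)
Lemma cholesky_MK : MK R [set k : 'I_n | schur_iter k C k k != 0]%SET (cholesky C).
Proof.
split=> [i j [|]|k]; first exact: cholesky_trig.
  by rewrite inE negbK => /eqP h; rewrite mxE h sqrtr0 invr0 mulr0.
rewrite inE => h; rewrite mxE; have := psd_diag_ge0 k (schur_iter_psd k).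
rewrite le_eqVlt eq_sym (negbTE h) /= => h'.
by rewrite divr_gt0 ?sqrtr_gt0.
Qed.

End Semidefinite.

Section Factor.
Variables (K : {set 'I_n}) (A : 'M[R]_n) (MA : MK R K A).

(** On a Gram matrix, eliminating the first [m] pivots discards the first [m]
    columns of the factor. *)
Lemma schur_iter_gram m (i j : 'I_n) : (m <= n)%N ->
  schur_iter m (A *m A^T) i j = \sum_(l < n | (m <= l)%N) A i l * A j l.
Proof.
elim: m i j => [|m IH] i j mn.
  by rewrite /= mxE; apply: eq_bigr => l _; rewrite mxE.
pose k := Ordinal mn.
have colk a : schur_iter m (A *m A^T) a k = A a k * A k k.
  rewrite IH ?(ltnW mn) // (bigD1 k) //= big1 ?addr0 // => l /andP[ml lk].
  by rewrite (MA.1 k l) ?mulr0 //; left; rewrite ltn_neqAle ml andbT eq_sym val_eqE.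
have rowk a : schur_iter m (A *m A^T) k a = A a k * A k k.
  by rewrite -colk !IH ?(ltnW mn) //; apply: eq_bigr => l _; rewrite mulrC.
rewrite (schur_iterS k) schurE /= !rowk !colk IH ?(ltnW mn) // (bigD1 k) //=.
rewrite (eq_bigl (fun l : 'I_n => (m.+1 <= l)%N)); last first.
  by move=> l; rewrite ltn_neqAle andbC [m == _]eq_sym -val_eqE.
suff -> : (A k k * A k k)^-1 * (A i k * A k k * (A j k * A k k)) = A i k * A j k.
  by rewrite addrAC subrr add0r.
case: (boolP (k \in K)) => [/(MA.2 k)/lt0r_neq0 h|h]; first by field.
by rewrite (MA.1 i k) ?(MA.1 k k) ?mul0r ?mulr0 //; right.
Qed.

Lemma schur_iter_col i (k : 'I_n) :
  schur_iter k (A *m A^T) i k = A i k * A k k.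
Proof.
rewrite schur_iter_gram ?(ltnW (ltn_ord k)) // (bigD1 k) //=.
rewrite big1 ?addr0 // => l /andP[ml lk].
by rewrite (MA.1 k l) ?mulr0 //; left; rewrite ltn_neqAle ml andbT eq_sym val_eqE.
Qed.

Lemma choleskyK : cholesky (A *m A^T) = A.
Proof.
apply/matrixP => i k; rewrite mxE !schur_iter_col.
case: (boolP (k \in K)) => [/(MA.2 k) h|h]; last first.
  by rewrite (MA.1 i k) ?mul0r //; right.
by rewrite -expr2 sqrtr_sqr gtr0_norm // mulfK // gt_eqF.
Qed.

Lemma MK_trig : is_trig_mx A.
Proof. by apply/is_trig_mxP => i j ij; apply: MA.1; left. Qed.

Lemma MK_proj : A *m coord_proj R K = A.
Proof.
apply/matrixP => i j; rewrite mul_coord_proj; case: ifPn => // jK.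
by rewrite MA.1 //; right.
Qed.

(** A matrix of [MK R K] is completed to an invertible lower triangular one. *)
Lemma MK_complete : exists2 L : 'M[R]_n, L \in unitmx /\ is_trig_mx L
  & A *m A^T = L *m coord_proj R K *m L^T.
Proof.
pose L := A + coord_proj R (~: K).
have tL : is_trig_mx L.
  apply/is_trig_mxP => i j ij; rewrite mxE (is_trig_mxP MK_trig) // coord_projE.
  by rewrite -val_eqE /= (ltn_eqF ij) addr0.
have AL : A = L *m coord_proj R K.
  suff h : coord_proj R (~: K) *m coord_proj R K = 0 by rewrite mulmxDl MK_proj h addr0.
  by apply: trmx_inj; rewrite trmx_mul !tr_coord_proj coord_proj_compl trmx0.
exists L; last first.
  by rewrite {1 2}AL trmx_mul tr_coord_proj !mulmxA -[L *m _ *m _]mulmxA coord_projK.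
split=> //; rewrite trig_unitmx //; apply/forallP => i.
rewrite mxE coord_projE eqxx inE /=; case: (boolP (i \in K)) => iK.
  by rewrite addr0 lt0r_neq0 // MA.2.
by rewrite MA.1 ?add0r ?oner_neq0 //; right.
Qed.

End Factor.

End Cholesky.

(** * Limits of matrices *)

Section MatrixLimits.
Context {R : realType} {T : Type} {F : set_system T} {FF : Filter F}.

Lemma cvg_mx m n (f : T -> 'M[R]_(m, n)) (M : 'M[R]_(m, n)) :
  (forall i j, f x i j @[x --> F] --> M i j) -> f @ F --> M.
Proof.
move=> h B [P MP PB]; rewrite /nbhs /=.
suff : F [set x | forall ij : 'I_m * 'I_n, P ij.1 ij.2 (f x ij.1 ij.2)].
  by apply: filterS => x Px; apply: PB => i j; exact: (Px (i, j)).
by apply: filter_forall => -[i j]; exact: (h i j _ (MP i j)).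
Qed.

Lemma cvg_mx_entry m n (f : T -> 'M[R]_(m, n)) (M : 'M[R]_(m, n)) i j :
  f @ F --> M -> f x i j @[x --> F] --> M i j.
Proof.
by move=> h; exact: (cvg_comp _ _ h (@coord_continuous R m n i j M)).
Qed.

Lemma cvg_sumr (I : Type) (r : seq I) (P : pred I) (f : I -> T -> R) (a : I -> R) :
  (forall i, P i -> f i x @[x --> F] --> a i) ->
  \sum_(i <- r | P i) f i x @[x --> F] --> \sum_(i <- r | P i) a i.
Proof.
move=> h; apply: (cvg_big (op := +%R)) => //.
by move=> x; apply: (@add_continuous R).
Qed.

End MatrixLimits.

(** * Positive semi-definite matrices in normal form *)

Section NormalForm.
Variables (R : realType) (n : nat) (K : {set 'I_n}).
Implicit Types (A C E : 'M[R]_n) (u v : 'cV[R]_n).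

Local Notation D := (coord_proj R K).

Lemma has_normal_form_rank C : has_normal_form K C -> (\rank C <= \rank D)%N.
Proof.
move=> [A [S /= [uA _ ND _]]].
have <- : \rank (A^T *m C *m A) = \rank C.
  by rewrite mxrankMfree ?row_free_unit // eqmxMfull // row_full_unit unitmx_tr.
by rewrite -ND mxrankM_maxr.
Qed.

Lemma coord_proj_sub (K' : {set 'I_n}) :
  (K' \subset K)%SET -> (coord_proj R K' <= D)%MS.
Proof.
move=> /fintype.subsetP sK.
suff <- : coord_proj R K' *m D = coord_proj R K' by exact: submxMl.
apply/matrixP => i j; rewrite mul_coord_proj coord_projE; case: ifPn => // jK.
by case: (boolP (j \in K')) => [/sK|]; rewrite ?andbF // (negbTE jK).
Qed.

Lemma coord_proj_sub_inv (K' : {set 'I_n}) :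
  (D <= coord_proj R K')%MS -> (K \subset K')%SET.
Proof.
case/submxP => X DX; apply/fintype.subsetP => k kK.
have := congr1 (fun M : 'M[R]_n => M k k) DX; rewrite /= coord_projE eqxx kK mul_coord_proj.
by case: ifP => // _ /eqP; rewrite oner_eq0.
Qed.

(** The set [K] of a normal form is unique: for a positive semi-definite matrix
    it is the set of nonzero pivots. *)
Lemma psd_normal_form_CK C : pos_semidef C -> has_normal_form K C -> CK R K C.
Proof.
move=> pC nC; have [A [S /= [uA tA ND NS]]] := nC.
pose B0 := cholesky C; have [K' MB] : exists K', MK R K' B0.
  by eexists; exact: cholesky_MK.
have CB : C = B0 *m B0^T by exact: choleskyP.
suff KK' : K = K' by exists B0 => //; rewrite KK'.
have sK : (K' \subset K)%SET.
  apply/fintype.subsetP => k kK'; apply/negPn/negP => kK.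
  pose B := A^T *m B0.
  have NB : A^T *m C *m A = B *m B^T by rewrite CB /B trmx_mul trmxK !mulmxA.
  have : (A^T *m C *m A) k k = 0 by rewrite -ND mul_coord_proj (negbTE kK).
  rewrite NB mxE => /eqP; rewrite psumr_eq0; last first.
    by move=> l _; rewrite [B^T _ _]mxE -expr2 sqr_ge0.
  move/allP => /(_ k (mem_index_enum _)) /=.
  rewrite [B^T _ _]mxE mulf_eq0 orbb trig_mulmx_diag ?(MK_trig MB) //.
  have /forallP dA : [forall i, A^T i i != 0] by rewrite -trig_unitmx // unitmx_tr.
  by rewrite mulf_eq0 (negbTE (dA k)) gt_eqF // MB.2.
apply/eqP; rewrite finset.eqEsubset sK andbT; apply: coord_proj_sub_inv.
rewrite -(geq_leqif (mxrank_leqif_sup (coord_proj_sub sK))).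
apply: leq_trans (_ : \rank C <= _)%N.
  rewrite -{1}NS; do 3 apply: leq_trans (mxrankM_maxl _ _) _.
  exact: mxrankM_maxr.
by rewrite CB; apply: leq_trans (mxrankM_maxl _ _) _; rewrite -(MK_proj MB) mxrankM_maxr.
Qed.

(** A symmetric matrix that is positive definite on the span of the [e_k], [k]
    in [K], and of rank at most [#|K|], is positive semi-definite: this span and
    the kernel then add up to the whole space. *)
Lemma psd_of_posdef_on E : Defs.symmetric E -> (\rank E <= \rank D)%N ->
  (forall v, D *m v = v -> v != 0 -> 0 < bform E v v) -> pos_semidef E.
Proof.
move=> sE rE pE; split=> // v; rewrite -/(bform E v v).
have cap0 : (D :&: kermx E)%MS = 0.
  apply/eqP/negPn/negP => /rowV0Pn[u]; rewrite sub_capmx.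
  move=> /andP[/submxP[w uD] /sub_kermxP uE] u0.
  have : 0 < bform E u^T u^T.
    apply: pE; last by rewrite -(inj_eq trmx_inj) trmxK trmx0.
    by rewrite uD trmx_mul tr_coord_proj mulmxA coord_projK.
  by rewrite /bform trmxK uE mul0mx mxE ltxx.
have full : row_full (D + kermx E)%MS.
  rewrite -col_leq_rank mxrank_disjoint_sum // mxrank_ker.
  by rewrite -[X in (X <= _)%N](subnKC (rank_leq_row E)) leq_add2r.
have /sub_addsmxP[[a b] /= vab] := submx_full v^T full.
have bE : b *m kermx E *m E = 0 by rewrite -mulmxA mulmx_ker mulmx0.
have -> : bform E v v = bform E (a *m D)^T (a *m D)^T.
  rewrite -[v]trmxK vab linearD /= !bformDl !bformDr.
  set w := (b *m kermx E)^T.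
  have w0 x : bform E w x = 0 by rewrite /bform /w trmxK bE mul0mx mxE.
  by rewrite (bformC _ w) // !w0 !addr0.
case: (eqVneq (a *m D)^T 0) => [->|h]; first by rewrite /bform mulmx0 mxE.
by apply/ltW/pE => //; rewrite trmx_mul tr_coord_proj mulmxA coord_projK.
Qed.

(** Quantitative openness of positive definiteness on the span of the [e_k]. *)
Lemma posdef_near E : \sum_i \sum_j `|E i j - D i j| < 1 ->
  forall v, D *m v = v -> v != 0 -> 0 < bform E v v.
Proof.
move=> hE v Dv v0; pose q := \sum_i v i 0 ^+ 2.
have q_ge i : v i 0 ^+ 2 <= q.
  by rewrite /q (bigD1 i) //= lerDl sumr_ge0 // => j _; exact: sqr_ge0.
have q0 : 0 < q.
  have [i vi] : exists i, v i 0 != 0.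
    apply/existsP; apply: contraNT v0; rewrite negb_exists => /forallP h.
    by apply/eqP/colP => i; rewrite mxE; exact/eqP/negPn.
  by apply: lt_le_trans (q_ge i); rewrite exprn_even_gt0.
have qD : bform D v v = q.
  by rewrite /bform -mulmxA Dv mxE; apply: eq_bigr => i _; rewrite mxE expr2.
have -> : bform E v v = q + bform (E - D) v v.
  by rewrite -qD !bformE -big_split; apply: eq_bigr => i _; rewrite -big_split;
    apply: eq_bigr => j _ /=; rewrite !mxE; ring.
suff h : `|bform (E - D) v v| < q.
  by have := h; rewrite ltr_norml => /andP[+ _]; lra.
rewrite bformE; apply: (@le_lt_trans _ _ (q * \sum_i \sum_j `|E i j - D i j|)); last first.
  by rewrite gtr_pMr.
apply: le_trans (ler_norm_sum _ _ _) _; rewrite mulr_sumr; apply: ler_sum => i _.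
apply: le_trans (ler_norm_sum _ _ _) _; rewrite mulr_sumr; apply: ler_sum => j _.
rewrite normrM !mxE ler_wpM2r // ler_norml.
have := q_ge i; have := q_ge j; have := sqr_ge0 (v i 0 - v j 0).
have := sqr_ge0 (v i 0 + v j 0).
rewrite !expr2 => *; apply/andP; split; nra.
Qed.

End NormalForm.

(** * The nonnegative part of the cell and its connectedness *)

Section Cells.
Variables (R : realType) (n : nat) (K : {set 'I_n}) (W : 'M[R]_(n + n)).
Hypothesis hW : weyl_lift (wK K) W.
Implicit Types (A C : 'M[R]_n) (u v : 'cV[R]_n).

Local Notation D := (coord_proj R K).
Local Notation coset := (double_coset (Bp R n) (PJp R n) W).

Lemma lower_unipK C : dlsubmx (lower_unip C : 'M[R]_(n + n)) = C.
Proof. exact: block_mxKdl. Qed.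

Lemma UJm_ge0_coset :
  UJm_ge0 R n `&` coset = [set lower_unip S | S in CK R K].
Proof.
apply/seteqP; split => [_ [[C pC <-] hC]|_ [_ [A MA <-] <-]].
  exists C => //; apply: psd_normal_form_CK => //.
  exact: (coset_normal_form hW pC.1 hC).
split; first by exists (A *m A^T) => //; exact: gram_psd.
have [L [uL tL] ->] := MK_complete MA; exact: normal_form_coset.
Qed.

Lemma coord_proj_MK : MK R K D.
Proof.
split=> [i j|k kK]; rewrite coord_projE; last by rewrite eqxx kK ltr01.
by case=> [ij|/negbTE ->]; rewrite ?andbF // -val_eqE /= (ltn_eqF ij).
Qed.

Lemma MK_convex A B (t : R) : 0 <= t <= 1 -> MK R K A -> MK R K B ->
  MK R K ((1 - t) *: A + t *: B).
Proof.
move=> /andP[t0 t1] MA MB; split=> [i j ij|k kK]; rewrite !mxE.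
  by rewrite MA.1 // MB.1 // !mulr0 addr0.
have a0 := MA.2 _ kK; have b0 := MB.2 _ kK.
case: (eqVneq t 0) => [->|tn]; first by rewrite subr0 mul1r mul0r addr0.
have tp : 0 < t by rewrite lt_neqAle eq_sym tn.
by rewrite ltr_wpDl ?mulr_gt0 // mulr_ge0 ?subr_ge0 // ltW.
Qed.

Lemma cvg_gram (T : Type) (F : set_system T) {FF : Filter F} (f : T -> 'M[R]_n) (A : 'M[R]_n) :
  (forall i j, f x i j @[x --> F] --> A i j) ->
  (lower_unip (f x *m (f x)^T) : 'M[R]_(n + n)) @[x --> F]
    --> (lower_unip (A *m A^T) : 'M[R]_(n + n)).
Proof.
move=> fA; apply: cvg_mx => i j.
case: (split_ordP i) => a ->; case: (split_ordP j) => b ->.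
- under eq_cvg do rewrite block_mxEul; rewrite block_mxEul; exact: cvg_cst.
- under eq_cvg do rewrite block_mxEur; rewrite block_mxEur; exact: cvg_cst.
- under eq_cvg do rewrite block_mxEdl mxE; rewrite block_mxEdl mxE.
  apply: cvg_sumr => k _; under eq_cvg do rewrite [_^T _ _]mxE.
  by rewrite [_^T _ _]mxE; apply: cvgM; exact: fA.
- under eq_cvg do rewrite block_mxEdr; rewrite block_mxEdr; exact: cvg_cst.
Qed.

Lemma cvg_bform (T : Type) (F : set_system T) {FF : Filter F} (f : T -> 'M[R]_n)
    (A : 'M[R]_n) u v :
  (forall i j, f x i j @[x --> F] --> A i j) ->
  bform (f x) u v @[x --> F] --> bform A u v.
Proof.
move=> fA; under eq_cvg do rewrite bformE; rewrite bformE.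
apply: cvg_sumr => i _; apply: cvg_sumr => j _.
by apply: cvgM; [exact: cvg_cst | exact: fA].
Qed.

Lemma continuous_dlsubmx (i j : 'I_n) :
  continuous (fun M : 'M[R]_(n + n) => dlsubmx M i j).
Proof.
have -> : (fun M : 'M[R]_(n + n) => dlsubmx M i j) =
          (fun M => M (rshift n i) (lshift n j)) by apply/funext => M; rewrite !mxE.
exact: coord_continuous.
Qed.

Lemma continuous_bform u v :
  continuous (fun M : 'M[R]_(n + n) => bform (dlsubmx M) u v).
Proof.
by move=> M; apply: (@cvg_bform _ (nbhs M) _ (@dlsubmx _ n n n n)) => i j;
  exact: continuous_dlsubmx.
Qed.

(** Straight segments in the convex set [MK R K] give paths in the cell. *)
Lemma cell_subset_component :
  UJm_ge0 R n `&` coset `<=`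
  connected_component (UJm R n `&` coset) (lower_unip D).
Proof.
move=> M hM; move: (hM); rewrite UJm_ge0_coset => -[_ [A MA <-] <-].
pose g (t : R) : 'M[R]_n := (1 - t) *: D + t *: A.
pose f (t : R) : 'M[R]_(n + n) := lower_unip (g t *m (g t)^T).
have f0 : f 0 = lower_unip D.
  by rewrite /f /g subr0 scale1r scale0r addr0 tr_coord_proj coord_projK.
have f1 : f 1 = lower_unip (A *m A^T) by rewrite /f /g subrr scale0r scale1r add0r.
exists (f @` `[0, 1]); last first.
  by exists 1 => //=; rewrite in_itv /= ler01 lexx.
split.
- by exists 0 => //=; rewrite in_itv /= lexx ler01.
- move=> y [t /=]; rewrite in_itv /= => t01 <-.
  suff : (UJm_ge0 R n `&` coset) (f t).
    by move=> [[C [sC _] <-] ?]; split=> //; exists C.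
  rewrite UJm_ge0_coset; exists (g t *m (g t)^T) => //; exists (g t) => //.
  by apply: MK_convex => //; exact: coord_proj_MK.
- apply: connected_continuous_connected; first exact: segment_connected.
  apply: continuous_subspaceT => t; apply: cvg_gram => i j.
  rewrite /g !mxE; under eq_cvg do rewrite !mxE.
  apply: cvgD; apply: cvgM; try exact: cvg_cst; last exact: cvg_id.
  by apply: cvgB; [exact: cvg_cst | exact: cvg_id].
Qed.

(** Inside the double coset the rank is bounded by [#|K|], hence positive
    semi-definiteness is an open condition there; it is always a closed one. *)
Lemma component_subset_cell :
  connected_component (UJm R n `&` coset) (lower_unip D) `<=`
  UJm_ge0 R n `&` coset.
Proof.
move=> M [B [BD sB cB] BM].
(* [h V] is the distance from the lower left block, read in the basis [V], to
   the projection [D], a form which is positive definite on the [e_k]. *)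
pose h V (M : 'M[R]_(n + n)) : R :=
  \sum_i \sum_j `|bform (dlsubmx M) (V *m delta_mx i 0) (V *m delta_mx j 0) - D i j|.
have hE V C : h V (lower_unip C) = \sum_i \sum_j `|(V^T *m C *m V) i j - D i j|.
  apply: eq_bigr => i _; apply: eq_bigr => j _.
  by rewrite lower_unipK -bform_congr bform_delta.
have ch V : continuous (h V).
  move=> N; apply: (@cvg_sumr R _ (nbhs N)) => i _.
  apply: (@cvg_sumr R _ (nbhs N)) => j _.
  apply: cvg_norm; apply: cvgB; last exact: cvg_cst.
  exact: continuous_bform.
have ge0_cell N : B N -> UJm_ge0 R n N -> (UJm_ge0 R n `&` coset) N.
  by move=> /sB[_ ?].
suff BE : B `&` UJm_ge0 R n = B.
  by move: BM; rewrite -{1}BE => -[BM]; exact: ge0_cell.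
apply: cB.
- exists (lower_unip D); split=> //; exists D => //.
  by rewrite -(coord_projK R K) -{2}tr_coord_proj; exact: gram_psd.
- exists (\bigcup_(V in [set V | V \in unitmx]) (h V @^-1` [set x | x < 1])).
    apply: bigcup_open => V _; apply: open_comp; last exact: open_lt.
    by move=> N _; exact: ch.
  apply/seteqP; split => [N [BN N0]|N [BN [V uV /= hN]]]; split=> //.
    have := ge0_cell _ BN N0; rewrite UJm_ge0_coset => -[_ [A MA <-] <-].
    have [L [uL tL] ->] := MK_complete MA.
    exists (invmx L^T); first by rewrite /= unitmx_inv unitmx_tr.
    rewrite /= hE big1 // => i _; rewrite big1 // => j _.
    rewrite trmx_inv trmxK !mulmxA mulVmx // mul1mx -mulmxA mulmxV ?unitmx_tr //.
    by rewrite mulmx1 subrr normr0.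
  have [[C sC NC] NW] := sB _ BN; rewrite -{N}NC in BN hN NW *.
  exists C => //; have rC := has_normal_form_rank (coset_normal_form hW sC NW).
  have sE : Defs.symmetric (V^T *m C *m V).
    by rewrite /Defs.symmetric !trmx_mul trmxK sC mulmxA.
  have rE : (\rank (V^T *m C *m V) <= \rank D)%N.
    apply: leq_trans (mxrankM_maxl _ _) _.
    by apply: leq_trans (mxrankM_maxr _ _) _.
  have pE : pos_semidef (V^T *m C *m V).
    by apply: psd_of_posdef_on sE rE _; apply: posdef_near; rewrite -hE.
  have := psd_congr (invmx V) pE.
  by rewrite !mulmxA mulmxK // -trmx_mul mulmxV // trmx1 mul1mx.
- exists (\bigcap_(v in [set: 'cV[R]_n])
      ((fun M : 'M[R]_(n + n) => bform (dlsubmx M) v v) @^-1` [set x | 0 <= x])).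
    apply: closed_bigI => v _.
    by move/continuous_closedP : (@continuous_bform v v); apply; exact: closed_ge.
  apply/seteqP; split => [N [BN [C pC NC]]|N [BN hN]]; split=> //.
    by move=> v _ /=; rewrite -NC lower_unipK; exact: pC.2.
  have [[C sC NC] _] := sB _ BN; exists C => //; split=> // v.
  by have := hN v I; rewrite /= -NC lower_unipK.
Qed.

Lemma cell_is_component :
  is_connected_component (UJm R n `&` coset) (UJm_ge0 R n `&` coset).
Proof.
exists (lower_unip D); last first.
  by apply/seteqP; split; [exact: cell_subset_component | exact: component_subset_cell].
suff : (UJm_ge0 R n `&` coset) (lower_unip D).
  by move=> [[C [sC _] <-] ?]; split=> //; exists C.
rewrite UJm_ge0_coset; exists D => //; exists D; first exact: coord_proj_MK.
by rewrite tr_coord_proj coord_projK.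
Qed.

End Cells.

(** * The homeomorphism *)

(** The nonzero pivots of a matrix of [CK R K] are those of index in [K]. *)
Lemma CK_pivot (R : realType) n (K : {set 'I_n}) (E : 'M[R]_n) (k : 'I_n) : CK R K E ->
  if k \in K then is_true (0 < schur_iter k E k k) else schur_iter k E k k = 0.
Proof.
move=> [A MA <-]; rewrite (schur_iter_col MA).
case: ifPn => kK; first by rewrite mulr_gt0 // MA.2.
by rewrite MA.1 ?mul0r //; right.
Qed.

Section CholeskyLimits.
Variables (R : realType) (n : nat) (K : {set 'I_n}).
Context {T : Type} {F : set_system T} {FF : Filter F}.
Variables (f : T -> 'M[R]_n) (C : 'M[R]_n).
Hypotheses (CC : CK R K C) (CF : \forall x \near F, CK R K (f x)).
Hypothesis fC : forall i j, f x i j @[x --> F] --> C i j.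

Lemma cvg_schur_iter m i j :
  schur_iter m (f x) i j @[x --> F] --> schur_iter m C i j.
Proof.
elim: m i j => [|m IH] i j; first exact: fC.
rewrite /=; case: insubP => [k _ km|_]; last exact: IH.
under eq_cvg do rewrite schurE; rewrite schurE.
apply: cvgB; first exact: IH.
apply: cvgM; last by apply: cvgM; exact: IH.
rewrite -km in IH *; have := CK_pivot k CC; case: (boolP (k \in K)) => kK.
  by move=> /lt0r_neq0 h; apply: cvgV => //; exact: IH.
move=> ->; apply: cvg_near_cst; apply: filterS CF => x /(CK_pivot k).
by rewrite (negbTE kK) => ->.
Qed.

(** The Cholesky factor depends continuously on the matrix within [CK R K]: the
    pivots in [K] stay away from zero and the other ones vanish identically. *)
Lemma cvg_cholesky i j : cholesky (f x) i j @[x --> F] --> cholesky C i j.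
Proof.
under eq_cvg do rewrite mxE; rewrite mxE.
apply: cvgM; first exact: cvg_schur_iter.
have cs : Num.sqrt (schur_iter j (f x) j j) @[x --> F] -->
    Num.sqrt (schur_iter j C j j).
  exact: (cvg_comp _ _ (@cvg_schur_iter j j j) (@sqrt_continuous R _)).
have := CK_pivot j CC; case: (boolP (j \in K)) => jK.
  by move=> h; apply: cvgV => //; rewrite lt0r_neq0 // sqrtr_gt0.
move=> ->; apply: cvg_near_cst; apply: filterS CF => x /(CK_pivot j).
by rewrite (negbTE jK) => ->.
Qed.

End CholeskyLimits.

Section Coordinates.
Variables (R : realType) (n : nat) (K : {set 'I_n}).

(** Positions (column, row) of the free entries below the diagonal of [MK R K]. *)
Definition low_pos : {set 'I_n * 'I_n} :=
  [set p : 'I_n * 'I_n | (p.1 \in K) && (p.1 < p.2)%N]%SET.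

Lemma card_low_pos : #|low_pos| = (\sum_(k in K) (n - k.+1))%N.
Proof.
rewrite -sum1_card.
rewrite (eq_bigl (fun p : 'I_n * 'I_n => (p.1 \in K) && (p.1 < p.2)%N)); last first.
  by move=> p; rewrite inE.
rewrite -(pair_big_dep (mem K) (fun i j : 'I_n => (i < j)%N) (fun _ _ => 1%N)) /=.
apply: eq_bigr => k _.
rewrite -(big_geq_mkord k.+1 n predT (fun _ => 1%N)) /=.
by rewrite sum_nat_const_nat muln1.
Qed.

Local Notation coords := ('rV[R]_#|K| * 'rV[R]_#|low_pos|)%type.

(** The matrix with prescribed diagonal entries in the columns of [K] and
    prescribed entries below them. *)
Definition mx_of_coords (v : coords) : 'M[R]_n := \matrix_(i, j)
  (\sum_s ((i == j) && (enum_val s == j))%:R * v.1 0 s +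
   \sum_t (enum_val t == (j, i))%:R * v.2 0 t).

Definition coords_of_mx (A : 'M[R]_n) : coords :=
  (\row_s A (enum_val s) (enum_val s),
   \row_t A (enum_val t).2 (enum_val t).1).

Lemma mx_of_coords_diag v (s : 'I_#|K|) :
  mx_of_coords v (enum_val s) (enum_val s) = v.1 0 s.
Proof.
rewrite mxE [X in _ + X]big1 => [|t _]; last first.
  case: eqP => [h|_]; last by rewrite mul0r.
  by have := enum_valP t; rewrite h inE /= ltnn andbF.
rewrite addr0 (bigD1 s) //= !eqxx mul1r big1 ?addr0 // => s' ss'.
by rewrite (inj_eq enum_val_inj) (negbTE ss') mul0r.
Qed.

Lemma mx_of_coords_low v (t : 'I_#|low_pos|) :
  mx_of_coords v (enum_val t).2 (enum_val t).1 = v.2 0 t.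
Proof.
rewrite mxE big1 => [|s _]; last first.
  have := enum_valP t; rewrite inE => /andP[_].
  by rewrite eq_sym -val_eqE /= => /ltn_eqF ->; rewrite mul0r.
rewrite add0r (bigD1 t) //= -surjective_pairing eqxx mul1r big1 ?addr0 // => t' tt'.
by rewrite (inj_eq enum_val_inj) (negbTE tt') mul0r.
Qed.

Lemma mx_of_coords0 v (i j : 'I_n) : (i < j)%N \/ j \notin K ->
  mx_of_coords v i j = 0.
Proof.
move=> h; rewrite mxE !big1 ?addr0 // => s _.
  case: (eqVneq (enum_val s) (j, i)) => [e|_]; last by rewrite mul0r.
  have := enum_valP s; rewrite e inE /= => /andP[jK ji].
  by case: h => [ij|]; [move: (ltn_trans ij ji); rewrite ltnn | rewrite jK].
case: (eqVneq (enum_val s) j) => [e|_]; last by rewrite andbF mul0r.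
case: h => [ij|]; first by rewrite -val_eqE /= (ltn_eqF ij) mul0r.
by rewrite -e enum_valP.
Qed.

Lemma mx_of_coords_MK v : pos_orthant_prod v -> MK R K (mx_of_coords v).
Proof.
move=> v0; split=> [i j|k kK]; first exact: mx_of_coords0.
by rewrite -(enum_rankK_in kK kK) mx_of_coords_diag; exact: v0.
Qed.

Lemma coords_of_mxK A : MK R K A -> mx_of_coords (coords_of_mx A) = A.
Proof.
move=> MA; apply/matrixP => i j.
case: (boolP (j \in K)) => jK; last by rewrite mx_of_coords0 ?MA.1 //; right.
case: (ltngtP i j) => [ij|ji|/val_inj ->].
- by rewrite mx_of_coords0 ?MA.1 //; left.
- have p : (j, i) \in low_pos by rewrite inE /= jK.
  have [t tE] : exists t : 'I_#|low_pos|, enum_val t = (j, i).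
    by exists (enum_rank_in p (j, i)); exact: enum_rankK_in.
  by have := mx_of_coords_low (coords_of_mx A) t; rewrite [RHS]mxE tE.
- have [s sE] : exists s : 'I_#|K|, enum_val s = j.
    by exists (enum_rank_in jK j); exact: enum_rankK_in.
  by have := mx_of_coords_diag (coords_of_mx A) s; rewrite [RHS]mxE sE.
Qed.

Lemma mx_of_coordsK v : coords_of_mx (mx_of_coords v) = v.
Proof.
case: v => a b; congr pair; apply/rowP => i; rewrite mxE.
  by rewrite mx_of_coords_diag.
by rewrite mx_of_coords_low.
Qed.

Lemma coords_of_mx_pos A : MK R K A -> pos_orthant_prod (coords_of_mx A).
Proof. by move=> MA i; rewrite /= mxE MA.2 // enum_valP. Qed.

Lemma CK_homeomorphic :
  homeomorphic ([set lower_unip S | S in CK R K] : set 'M[R]_(n + n))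
    (@pos_orthant_prod R #|K| #|low_pos|).
Proof.
pose f (M : 'M[R]_(n + n)) : coords := coords_of_mx (cholesky (dlsubmx M)).
pose g (v : coords) : 'M[R]_(n + n) :=
  lower_unip (mx_of_coords v *m (mx_of_coords v)^T).
exists f, g; split.
- split=> [_ [_ [A MA <-] <-]|v v0].
    by rewrite /f lower_unipK (choleskyK MA); exact: coords_of_mx_pos.
  exists (mx_of_coords v *m (mx_of_coords v)^T) => //.
  by exists (mx_of_coords v) => //; exact: mx_of_coords_MK.
- split=> [_ [_ [A MA <-] <-]|v v0].
    by rewrite /f /g lower_unipK (choleskyK MA) coords_of_mxK.
  by rewrite /f /g lower_unipK (choleskyK (mx_of_coords_MK v0)) mx_of_coordsK.
- apply/subspace_continuousP => M CM.
  set F := within _ _.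
  have FF : Filter F by exact: within_filter.
  have c i j : cholesky (dlsubmx N) i j @[N --> F] --> cholesky (dlsubmx M) i j.
    apply: (cvg_cholesky (K := K)).
    + by case: CM => C CC <-; rewrite lower_unipK.
    + have : F [set lower_unip S | S in CK R K] by exact: withinT.
      by apply: filterS => N [C CC <-]; rewrite lower_unipK.
    + move=> a b; apply: cvg_within_filter; exact: continuous_dlsubmx.
  have h1 : (f N).1 @[N --> F] --> (f M).1.
    by apply: cvg_mx => i j; rewrite mxE; under eq_cvg do rewrite mxE; exact: c.
  have h2 : (f N).2 @[N --> F] --> (f M).2.
    by apply: cvg_mx => i j; rewrite mxE; under eq_cvg do rewrite mxE; exact: c.
  exact: (cvg_pair h1 h2).
- apply: continuous_subspaceT => v.
  apply: (@cvg_gram _ _ _ (nbhs v)) => i j; rewrite mxE.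
  under eq_cvg do rewrite mxE.
  apply: cvgD; apply: (@cvg_sumr R _ (nbhs v)) => s _; apply: cvgM; try exact: cvg_cst.
    by apply: cvg_mx_entry; exact: cvg_fst.
  by apply: cvg_mx_entry; exact: cvg_snd.
Qed.

End Coordinates.

Theorem proposition5p15 (R : realType) (n : nat) (hn : (1 <= n)%N)
    (K : {set 'I_n}) (wdot : 'M[R]_(n + n)) (hwdot : weyl_lift (wK K) wdot) :
  [/\ is_connected_component
        (UJm R n `&` double_coset (Bp R n) (PJp R n) wdot)
        (UJm_ge0 R n `&` double_coset (Bp R n) (PJp R n) wdot),
      UJm_ge0 R n `&` double_coset (Bp R n) (PJp R n) wdot
        = [set lower_unip S | S in CK R K]
    & homeomorphic
        (UJm_ge0 R n `&` double_coset (Bp R n) (PJp R n) wdot)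
        (@pos_orthant_prod R #|K| (\sum_(k in K) (n - k.+1))%N)].
Proof.
have cellE := UJm_ge0_coset hwdot.
split; [exact: (cell_is_component hwdot) | exact: cellE |].
by rewrite cellE -(card_low_pos K); exact: CK_homeomorphic.
Qed.
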